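(* Let $M:\mathbb{R}^l\times\mathbb{R}^n\rightrightarrows\mathbb{R}^m$ be a set-valued mapping and $S(p):=\{x\in\mathbb{R}^n\mid0\in M(p,x)\}$. Assume that $M$ has locally closed graph around $(\bar p,\bar x,0)\in\mathrm{gph}\,M$ and let $P\subset\mathbb{R}^l$ be a closed set containing $\bar p$. Further assume that (i) for every $q\in T_P(\bar p)$ and every sequence $t_k\downarrow0$ there exists some $u\in\mathbb{R}^n$ satisfying $$\liminf_{k\to\infty}\ \mathrm{dist}\big((\bar p+t_kq,\bar x+t_ku,0),\mathrm{gph}\,M\big)/t_k=0;$$ (ii) for every nonzero $(q,u)\in T_P(\bar p)\times\mathbb{R}^n$ verifying $0\in DM(\bar p,\bar x,0)(q,u)$ one has the implication $$(q^*,0)\in D^*M\big((\bar p,\bar x,0);(q,u,0)\big)(v^* )\ \Rightarrow\ q^*=0\ \text{and}\ v^*=0.$$ Then $S$ has the Aubin property relative to $P$ around $(\bar p,\bar x)$, and for any $q\in T_P(\bar p)$ $$DS(\bar p,\bar x)(q)=\{u\in\mathbb{R}^n\mid0\in DM(\bar p,\bar x,0)(q,u)\}.$$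
   Context: $T_\Omega(\bar z):=\{u\mid\exists u_k\to u,\ t_k\downarrow0:\ \bar z+t_ku_k\in\Omega\ \forall k\}$ is the tangent cone; $\widehat N_\Omega(\bar z):=T_\Omega(\bar z)^\circ$ (negative polar) for $\bar z\in\Omega$ and $\emptyset$ otherwise is the regular normal cone; the directional limiting normal cone in direction $u$ is $N_\Omega(\bar z;u):=\mathop{\mathrm{Lim\,sup}}_{t\downarrow0,\,u'\to u}\widehat N_\Omega(\bar z+tu')$ (Painlevé–Kuratowski outer limit), i.e. the set of limits of $z_k^*\in\widehat N_\Omega(\bar z+t_ku_k)$ with $t_k\downarrow0$, $u_k\to u$. Graphical derivative: $DF(\bar x,\bar y)(u):=\{v\mid(u,v)\in T_{\mathrm{gph}\,F}(\bar x,\bar y)\}$; $DM(\bar p,\bar x,0)$ is the graphical derivative of $M$ at $((\bar p,\bar x),0)$. Directional limiting coderivative: $D^*M((\bar p,\bar x,0);(q,u,0))(v^* ):=\{(q^*,u^* )\in\mathbb{R}^l\times\mathbb{R}^n\mid(q^*,u^*,-v^* )\in N_{\mathrm{gph}\,M}((\bar p,\bar x,0);(q,u,0))\}$. Aubin property of $S$ relative to $P$ around $(\bar p,\bar x)$: there are neighborhoods $V$ of $\bar p$, $U$ of $\bar x$ and $L\ge0$ with $S(p)\cap U\subset S(p')+L\|p-p'\|\mathcal{B}$ for all $p,p'\in P\cap V$, where $\mathcal{B}$ is the closed unit ball. *)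

(* Defs.v *)
From HB Require Import structures.
From mathcomp Require Import all_boot all_order all_algebra.
From mathcomp Require Import all_classical all_reals all_analysis.

Set Implicit Arguments.
Unset Strict Implicit.
Unset Printing Implicit Defensive.

Import Order.TTheory GRing.Theory Num.Theory.
Import numFieldNormedType.Exports.
Local Open Scope classical_set_scope.
Local Open Scope ring_scope.

(* R^d is 'rV[R]_d with its library topology, and R^d1 x R^d2 is
   'rV[R]_(d1 + d2), pairs being written row_mx x y.  The library norm on
   'rV[R]_d is the sup norm; distances and balls below are Euclidean. *)

Definition dotv (R : realType) (d : nat) (x y : 'rV[R]_d) : R :=
  \sum_(i < d) x 0 i * y 0 i.

Definition enorm (R : realType) (d : nat) (x : 'rV[R]_d) : R :=
  Num.sqrt (dotv x x).

Definition closed_unit_ball (R : realType) (d : nat) : set 'rV[R]_d :=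
  [set b | enorm b <= 1].

(* Only meaningful for nonempty Omega, since inf set0 = 0. *)
Definition dist (R : realType) (d : nat) (z : 'rV[R]_d)
    (Omega : set 'rV[R]_d) : R :=
  inf [set enorm (z - w) | w in Omega].

(* t_k \downarrow 0, i.e. t_k -> 0 with t_k > 0; monotonicity is not required *)
Definition decr_to0 (R : realType) (t : nat -> R) : Prop :=
  (forall k, 0 < t k) /\ t @ \oo --> (0 : R).

Definition tangent_cone (R : realType) (d : nat) (Omega : set 'rV[R]_d)
    (z : 'rV[R]_d) : set 'rV[R]_d :=
  [set u | exists (u_ : nat -> 'rV[R]_d) (t : nat -> R),
    [/\ u_ @ \oo --> u, decr_to0 t &
        forall k, Omega (z + t k *: u_ k)]].

Definition polar_cone (R : realType) (d : nat) (K : set 'rV[R]_d) :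
    set 'rV[R]_d :=
  [set zs | forall u, K u -> dotv zs u <= 0].

Definition regular_normal_cone (R : realType) (d : nat)
    (Omega : set 'rV[R]_d) (z : 'rV[R]_d) : set 'rV[R]_d :=
  [set zs | Omega z /\ polar_cone (tangent_cone Omega z) zs].

Definition directional_normal_cone (R : realType) (d : nat)
    (Omega : set 'rV[R]_d) (z u : 'rV[R]_d) : set 'rV[R]_d :=
  [set zs | exists (t : nat -> R) (u_ zs_ : nat -> 'rV[R]_d),
    [/\ decr_to0 t, u_ @ \oo --> u, zs_ @ \oo --> zs &
        forall k, regular_normal_cone Omega (z + t k *: u_ k) (zs_ k)]].

Definition gph (R : realType) (d e : nat) (F : 'rV[R]_d -> set 'rV[R]_e) :
    set 'rV[R]_(d + e) :=
  [set z | F (lsubmx z) (rsubmx z)].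

Definition graphical_derivative (R : realType) (d e : nat)
    (F : 'rV[R]_d -> set 'rV[R]_e) (x : 'rV[R]_d) (y : 'rV[R]_e)
    (u : 'rV[R]_d) : set 'rV[R]_e :=
  [set v | tangent_cone (gph F) (row_mx x y) (row_mx u v)].

(* D^*F((x,y);(u,v))(vs) *)
Definition directional_coderivative (R : realType) (d e : nat)
    (F : 'rV[R]_d -> set 'rV[R]_e) (x : 'rV[R]_d) (y : 'rV[R]_e)
    (u : 'rV[R]_d) (v : 'rV[R]_e) (vs : 'rV[R]_e) : set 'rV[R]_d :=
  [set us | directional_normal_cone (gph F) (row_mx x y) (row_mx u v)
              (row_mx us (- vs))].

Definition locally_closed_at (R : realType) (d : nat) (Omega : set 'rV[R]_d)
    (z : 'rV[R]_d) : Prop :=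
  exists W : set 'rV[R]_d, [/\ nbhs z W, closed W & closed (Omega `&` W)].

Definition solution_map (R : realType) (l n m : nat)
    (M : 'rV[R]_(l + n) -> set 'rV[R]_m) (p : 'rV[R]_l) : set 'rV[R]_n :=
  [set x | M (row_mx p x) 0].

Definition aubin_relative (R : realType) (l n : nat)
    (S : 'rV[R]_l -> set 'rV[R]_n) (P : set 'rV[R]_l)
    (p0 : 'rV[R]_l) (x0 : 'rV[R]_n) : Prop :=
  exists (V : set 'rV[R]_l) (U : set 'rV[R]_n) (L : R),
    [/\ nbhs p0 V, nbhs x0 U, 0 <= L &
        forall p p', (P `&` V) p -> (P `&` V) p' ->
          S p `&` U `<=`
          [set y + (L * enorm (p - p')) *: b
             | y in S p' & b in @closed_unit_ball R n]].

(* Main.v *)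
Require Import Defs.
From mathcomp Require Import all_boot all_order all_algebra.
From mathcomp Require Import all_classical all_reals all_analysis.
From mathcomp Require Import ring lra.
Import Order.TTheory GRing.Theory Num.Theory.
Import numFieldNormedType.Exports.
Local Open Scope classical_set_scope.
Local Open Scope ring_scope.

(** The heart of the proof is a local surjectivity estimate along one
    direction.  Let [(q, u) <> (0, 0)] be admissible in (ii), let
    [(ph, xh, yh)] be a point of [gph M] and [p'] a parameter, both lying at
    [(pbar, xbar, 0) + t (q, u, 0)] up to [o(t)].  Then some solution [x'] at
    [p'] satisfies [|x' - xh| <= L |(ph - p', yh)|]
    ([directional_regularity]).

    Suppose that this fails, and put [r = |(ph - p', yh)|].  Minimise the
    penalty [|(p - p', y)| + |x - xh|^2 / (L^2 r)] over [gph M] near the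
    reference point.  The minimiser [z] has value at most [r], so it stays
    within [L r] of [(ph, xh, yh)]; the first term cannot vanish at [z], since
    the [x] component of [z] would then be the solution that is missing.  The
    penalty is therefore differentiable at [z], and minus its gradient is a
    regular normal to [gph M] whose [(p, y)] part has norm one and whose [x]
    part has norm at most [2 / L] ([penalized_projection_normal]).  Letting
    [L] tend to infinity while [L r = o(t)], the base points still converge in
    the direction [(q, u, 0)], and a limit of these normals is a nonzero
    directional limiting normal of the form [(qs, 0, ys)], against (ii).  This
    replaces Ekeland's principle, since bounded closed sets are compact here.

    Compactness of the unit sphere of directions turns this into an estimate
    with one pair of constants for all points of [gph M] near the reference
    point and all [p'] in [P], as long as [|yh|] and [|p' - ph|] are small
    compared with the distance [t] from [(ph, xh)] to [(pbar, xbar)]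
    ([uniform_regularity]).  Parameters [p'] that are not small compared with
    [t] are reached from [xbar] instead: by (i) there are points of [gph M]
    approximating [(p', xbar + t u, 0)] with [t] now equal to [|p' - pbar|],
    and the uniform estimate corrects them to solutions at distance
    [O(|p' - pbar|)] from [xbar] ([solution_near_reference]).  The Aubin
    property combines the two regimes ([aubin_relativeI]).

    For the graphical derivative only one inclusion needs an argument: tangent
    points of [gph M] in a nonzero direction [(q, u, 0)] are corrected to
    points of [gph S] by the directional estimate with the parameter kept
    ([graphical_derivative_solution_sup]). *)

(** * Euclidean products and norms of row vectors *)

Lemma dotvC {R : realType} {d : nat} (x y : 'rV[R]_d) : dotv x y = dotv y x.
Proof. by apply: eq_bigr => i _; rewrite mulrC. Qed.

Lemma dotvDl {R : realType} {d : nat} (x y z : 'rV[R]_d) :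
  dotv (x + y) z = dotv x z + dotv y z.
Proof. by rewrite -big_split /=; apply: eq_bigr => i _; rewrite mxE mulrDl. Qed.

Lemma dotvZl {R : realType} {d : nat} (a : R) (x y : 'rV[R]_d) :
  dotv (a *: x) y = a * dotv x y.
Proof. by rewrite mulr_sumr; apply: eq_bigr => i _; rewrite mxE mulrA. Qed.

Lemma dotvDr {R : realType} {d : nat} (x y z : 'rV[R]_d) :
  dotv z (x + y) = dotv z x + dotv z y.
Proof. by rewrite dotvC dotvDl ![dotv z _]dotvC. Qed.

Lemma dotvZr {R : realType} {d : nat} (a : R) (x y : 'rV[R]_d) :
  dotv x (a *: y) = a * dotv x y.
Proof. by rewrite dotvC dotvZl dotvC. Qed.

Lemma dotvNl {R : realType} {d : nat} (x y : 'rV[R]_d) :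
  dotv (- x) y = - dotv x y.
Proof. by rewrite -scaleN1r dotvZl mulN1r. Qed.

Lemma dotv0 {R : realType} {d : nat} (x : 'rV[R]_d) : dotv x 0 = 0.
Proof. by apply: big1 => i _; rewrite mxE mulr0. Qed.

Lemma dotv_ge0 {R : realType} {d : nat} (x : 'rV[R]_d) : 0 <= dotv x x.
Proof. by apply: sumr_ge0 => i _; rewrite -expr2 sqr_ge0. Qed.

Lemma dotv_sqrD {R : realType} {d : nat} (x y : 'rV[R]_d) :
  dotv (x + y) (x + y) = dotv x x + 2 * dotv x y + dotv y y.
Proof. by rewrite dotvDl !dotvDr [dotv y x]dotvC; ring. Qed.

Lemma dotv_row_mx {R : realType} {d e : nat} (a b : 'rV[R]_d) (x y : 'rV[R]_e) :
  dotv (row_mx a x) (row_mx b y) = dotv a b + dotv x y.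
Proof.
rewrite /dotv big_split_ord /=.
by congr (_ + _); apply: eq_bigr => i _; rewrite ?row_mxEl ?row_mxEr.
Qed.

Lemma sqr_enorm {R : realType} {d : nat} (x : 'rV[R]_d) :
  enorm x ^+ 2 = dotv x x.
Proof. by rewrite sqr_sqrtr // dotv_ge0. Qed.

Lemma enorm_ge0 {R : realType} {d : nat} (x : 'rV[R]_d) : 0 <= enorm x.
Proof. exact: sqrtr_ge0. Qed.

Lemma enormZ {R : realType} {d : nat} (a : R) (x : 'rV[R]_d) :
  0 <= a -> enorm (a *: x) = a * enorm x.
Proof.
move=> a0; rewrite /enorm dotvZl dotvZr mulrA -expr2 sqrtrM ?sqr_ge0 //.
by rewrite sqrtr_sqr ger0_norm.
Qed.

Lemma rV_norm_leP {R : realType} {d : nat} (x : 'rV[R]_d) (e : R) : 0 <= e ->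
  reflect (forall i, `|x 0 i| <= e) (`|x| <= e).
Proof.
move=> e0; rewrite /Num.norm /= mx_normrE.
apply: (iffP (bigmax_leP _ _ _ _)) => [[_ h] i|h]; first exact: (h (0, i)).
by split => // -[i j] _ /=; rewrite (ord1 i); exact: h.
Qed.

Lemma coord_le_norm {R : realType} {d : nat} (x : 'rV[R]_d) i :
  `|x 0 i| <= `|x|.
Proof. by move: i; apply: (elimT (rV_norm_leP _ _ _)). Qed.

Lemma norm_le_enorm {R : realType} {d : nat} (x : 'rV[R]_d) : `|x| <= enorm x.
Proof.
apply/rV_norm_leP => [|i]; first exact: enorm_ge0.
rewrite -sqrtr_sqr ler_wsqrtr // /dotv (bigD1 i) //= -expr2 lerDl.
by apply: sumr_ge0 => j _; rewrite -expr2 sqr_ge0.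
Qed.

Lemma enorm_le_norm {R : realType} {d : nat} (x : 'rV[R]_d) :
  enorm x <= d%:R * `|x|.
Proof.
have b0 : 0 <= d%:R * `|x| by rewrite mulr_ge0.
rewrite -(ler_pXn2r (n := 2)) ?nnegrE ?enorm_ge0 // sqr_enorm exprMn.
have : dotv x x <= \sum_(i < d) `|x| ^+ 2.
  apply: ler_sum => i _; rewrite -expr2 -real_normK ?num_real //.
  by rewrite ler_pXn2r ?nnegrE //; exact: coord_le_norm.
rewrite sumr_const card_ord => /le_trans; apply.
rewrite -[_ *+ d]mulr_natl ler_wpM2r ?sqr_ge0 // -natrX ler_nat.
by case: d {x b0} => // d; rewrite leq_pmull.
Qed.

Lemma enorm_eq0 {R : realType} {d : nat} (x : 'rV[R]_d) : enorm x = 0 -> x = 0.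
Proof.
by move=> e0; apply/normr0_eq0/eqP; rewrite eq_le normr_ge0 -{1}e0 norm_le_enorm.
Qed.

Lemma enorm_gt0 {R : realType} {d : nat} (x : 'rV[R]_d) : x <> 0 -> 0 < enorm x.
Proof.
by move=> x0; rewrite lt_neqAle enorm_ge0 andbT eq_sym; apply/eqP => /enorm_eq0.
Qed.

(** The multiple is also available for [s = 0], where [v] has to vanish; this is
    what the Aubin property asks for when the two parameters coincide. *)
Lemma scaled_unit_ball {R : realType} {d : nat} (v : 'rV[R]_d) (s : R) :
  enorm v <= s -> exists2 b, closed_unit_ball b & v = s *: b.
Proof.
move=> vs; have [s0|s0] := eqVneq s 0.
  exists 0; first by rewrite /closed_unit_ball /= /enorm dotv0 sqrtr0.
  rewrite scaler0; apply: enorm_eq0.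
  by apply/eqP; rewrite eq_le enorm_ge0 andbT -s0.
have sp : 0 < s by rewrite lt_neqAle eq_sym s0 (le_trans (enorm_ge0 v)).
exists (s^-1 *: v); last by rewrite scalerA divff // scale1r.
by rewrite /closed_unit_ball /= enormZ ?invr_ge0 ?(ltW sp) // ler_pdivrMl // mulr1.
Qed.

Lemma norm_row_mx {R : realType} {d e : nat} (x : 'rV[R]_d) (y : 'rV[R]_e) :
  `|row_mx x y| = Num.max `|x| `|y|.
Proof.
have m0 : 0 <= Num.max `|x| `|y| by rewrite le_max normr_ge0.
apply/eqP; rewrite eq_le; apply/andP; split.
  apply/rV_norm_leP => // i; rewrite mxE le_max.
  by case: (fintype.split i) => j; rewrite coord_le_norm ?orbT.
rewrite ge_max; apply/andP; split; apply/rV_norm_leP => // i.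
  by rewrite -(row_mxEl x y); exact: coord_le_norm.
by rewrite -(row_mxEr x y); exact: coord_le_norm.
Qed.

Lemma norm_row_mx_le {R : realType} {d e : nat} (x : 'rV[R]_d) (y : 'rV[R]_e) r :
  (`|row_mx x y| <= r) = (`|x| <= r) && (`|y| <= r).
Proof. by rewrite norm_row_mx ge_max. Qed.

Lemma norm_row_mx_lt {R : realType} {d e : nat} (x : 'rV[R]_d) (y : 'rV[R]_e) r :
  (`|row_mx x y| < r) = (`|x| < r) && (`|y| < r).
Proof. by rewrite norm_row_mx gt_max. Qed.

Lemma enorm_row_mx0 {R : realType} {d e : nat} (x : 'rV[R]_d) :
  enorm (row_mx x (0 : 'rV[R]_e)) = enorm x.
Proof. by rewrite /enorm dotv_row_mx dotv0 addr0. Qed.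

Lemma enorm_row_mx_le {R : realType} {d e : nat} (x : 'rV[R]_d) (y : 'rV[R]_e) r :
  `|x| <= r -> `|y| <= r -> enorm (row_mx x y) <= (d + e)%:R * r.
Proof.
move=> hx hy; apply: (le_trans (enorm_le_norm _)).
by rewrite ler_wpM2l // norm_row_mx_le hx hy.
Qed.

Lemma row_mx_sub {R : realType} {d e : nat} (a b : 'rV[R]_d) (x y : 'rV[R]_e) :
  row_mx a x - row_mx b y = row_mx (a - b) (x - y).
Proof. by rewrite opp_row_mx add_row_mx. Qed.

Lemma row_mx3P {R : realType} {l n m : nat} (z : 'rV[R]_(l + n + m)) :
  exists p x y, z = row_mx (row_mx p x) y.
Proof.
by exists (lsubmx (lsubmx z)), (rsubmx (lsubmx z)), (rsubmx z); rewrite !hsubmxK.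
Qed.

Lemma ler_norm_sub3 {R : realType} {V : normedModType R} (a b c : V) (r s : R) :
  `|a - b| <= r -> `|b - c| <= s -> `|a - c| <= r + s.
Proof.
by move=> ab bc; rewrite -(subrK b a) -addrA (le_trans (ler_normD _ _)) ?lerD.
Qed.

(** * Limits, cluster points and compactness *)

Lemma cvg_dotv {R : realType} {d : nat} {T : Type} {F : set_system T}
    {FF : Filter F} (f g : T -> 'rV[R]_d) (a b : 'rV[R]_d) :
  f @ F --> a -> g @ F --> b -> (fun t => dotv (f t) (g t)) @ F --> dotv a b.
Proof.
move=> fa gb; apply: cvg_big => [|i _]; first exact: add_continuous.
have c (h : T -> 'rV[R]_d) (v : 'rV[R]_d) : h @ F --> v -> (fun t => h t 0 i) @ F --> v 0 i.
  by move=> hv; apply: (cvg_comp h (fun x : 'rV[R]_d => x 0 i) hv); exact: coord_continuous.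
by apply: cvgM; exact: c.
Qed.

Lemma exists_inv_lt {R : realType} (e : R) : 0 < e ->
  exists N, forall k, (N <= k)%N -> k.+1%:R^-1 < e.
Proof.
move=> e0; have [N _ h] := near_infty_natSinv_lt (PosNum e0).
by exists N => k /h.
Qed.

Lemma cvg_inv_bound {R : realType} {V : normedModType R} (f : nat -> V) (a : V) :
  (forall k, `|f k - a| < k.+1%:R^-1) -> f @ \oo --> a.
Proof.
move=> fa; apply/cvgrPdist_lt => e e0.
have := near_infty_natSinv_lt (PosNum e0); apply: filterS => k /=.
by rewrite distrC; exact: lt_trans.
Qed.

(** Bolzano-Weierstrass, stated through a cluster point so that no subsequence
    has to be named. *)
Lemma unit_sphere_cluster {R : realType} {d : nat} (w : nat -> 'rV[R]_d) :
  (forall k, enorm (w k) = 1) ->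
  exists2 w0, enorm w0 = 1 &
    forall e N, 0 < e -> exists2 k, (N <= k)%N & `|w k - w0| < e.
Proof.
move=> w1.
pose A := [set x : 'rV[R]_d | dotv x x = 1].
have cA : closed A.
  apply: (preimage_closed (f := fun x : 'rV[R]_d => dotv x x) (D := [set 1])).
    by move=> x _; apply: (@cvg_dotv R d _ (nbhs x) (nbhs_filter x) id id x x); exact: cvg_id.
  exact: closed_eq.
have bA : bounded_set A.
  exists 1; split; first exact: num_real.
  move=> M M1 x /= Ax; apply: le_trans (ltW M1).
  by apply: le_trans (norm_le_enorm _) _; rewrite /enorm Ax sqrtr1.
have := bounded_closed_compact bA cA => /(_ (w @ \oo) _) [|w0 [Aw0 clw]].
  by exists 0 => // k _ /=; rewrite /A /= -sqr_enorm w1 expr1n.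
exists w0; first by rewrite /enorm Aw0 sqrtr1.
move=> e N e0.
have [||x [[k Nk <-] /= hk]] := clw (w @` [set k | (N <= k)%N]) (ball w0 e).
- by exists N => // k Nk; exists k.
- exact: nbhsx_ballx.
by exists k => //; move: hk; rewrite -ball_normE /= distrC.
Qed.

(** Truncating the set to a small ball gives the compact set over which the
    penalty is minimised. *)
Lemma locally_closed_compact {R : realType} {d : nat} (Omega : set 'rV[R]_d)
    (z : 'rV[R]_d) : locally_closed_at Omega z ->
  exists2 rho : R, 0 < rho & compact (Omega `&` [set w | `|w - z| <= rho]).
Proof.
move=> [W [/nbhs_ballP[e /= e0 eW] cW cOW]]; exists (e / 2); first by rewrite divr_gt0.
have -> : Omega `&` [set w | `|w - z| <= e / 2] =
    (Omega `&` W) `&` closed_ball z (e / 2).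
  rewrite closed_ballE ?divr_gt0 //; apply/seteqP; split => w /=.
    move=> [Ow we]; split; last by rewrite /closed_ball_ /= distrC.
    split => //; apply: eW; rewrite -ball_normE /= distrC.
    by apply: (le_lt_trans we); rewrite ltr_pdivrMr // ltr_pMr // ltr1n.
  by rewrite /closed_ball_ /= distrC => -[[? _] ?].
apply: bounded_closed_compact; last first.
  by apply: closedI => //; exact: closed_ball_closed.
exists (`|z| + e / 2); split; first exact: num_real.
move=> B zB w /= [_]; rewrite closed_ballE ?divr_gt0 // /closed_ball_ /= => zw.
apply: le_trans (ltW zB); rewrite -(subrK z w) addrC.
by apply: (le_trans (ler_normD _ _)); rewrite lerD2l distrC.
Qed.

(** A tail staying above a positive [e] would bound the lower limit below by [e]. *)
Lemma limn_einf0_lt {R : realType} (a : nat -> R) :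
  limn_einf (fun k => (a k)%:E) = 0%E ->
  forall e N, 0 < e -> exists2 k, (N <= k)%N & a k < e.
Proof.
move=> lim0 e N e0; apply: contrapT => h.
have ge k : (N <= k)%N -> e <= a k.
  by move=> Nk; rewrite leNgt; apply/negP => ak; apply: h; exists k.
suff : (limn_esup (\- (fun k => (a k)%:E))%E <= - e%:E)%E.
  by rewrite limn_esupN lim0 oppe0 -EFinN lee_fin oppr_ge0 leNgt e0.
rewrite /limn_esup /limf_esup.
apply: ge_ereal_inf; exists (ereal_sup [set (- (a k)%:E)%E | k in [set k | (N <= k)%N]]).
  by exists [set k | (N <= k)%N] => //; exists N.
apply: ge_ereal_sup => _ [k /= Nk <-].
by rewrite lee_fin lerN2 ge.
Qed.

Lemma dist_lt {R : realType} {d : nat} (z w0 : 'rV[R]_d) (Omega : set 'rV[R]_d) e :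
  Omega w0 -> dist z Omega < e -> exists2 w, Omega w & enorm (z - w) < e.
Proof.
move=> Ow0 /inf_lt[|_ [w Ow <-] ?]; last by exists w.
by exists (enorm (z - w0)); exists w0.
Qed.

(** * Tangent and normal cones *)

(** Sequences are traded for one small parameter [e]: countable choice along
    [e = 1 / (k + 1)] rebuilds the two sequences of the definition. *)
Lemma tangent_coneP {R : realType} {d : nat} (Omega : set 'rV[R]_d)
    (z u : 'rV[R]_d) :
  tangent_cone Omega z u <->
  forall e, 0 < e -> exists (t : R) (w : 'rV[R]_d),
    [/\ 0 < t, t < e, `|w - u| < e & Omega (z + t *: w)].
Proof.
split => [[w [t [wu [t0 tc] O]]] e e0|h].
  have /cvgrPdist_lt/(_ _ e0) wn := wu.
  have /cvgrPdist_lt/(_ _ e0) tn := tc.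
  have [N _ /(_ N (leqnn N)) /= [h1 h2]] := filterI wn tn.
  exists (t N), (w N); split => //; last by rewrite distrC.
  by move: h2; rewrite sub0r normrN gtr0_norm.
have hk k : exists tw : R * 'rV[R]_d, [/\ 0 < tw.1, tw.1 < k.+1%:R^-1,
    `|tw.2 - u| < k.+1%:R^-1 & Omega (z + tw.1 *: tw.2)].
  by have [|t [w ?]] := h k.+1%:R^-1; [rewrite invr_gt0|exists (t, w)].
have [f fP] := choice hk.
exists (snd \o f), (fst \o f); split => [||k]; last by case: (fP k).
- by apply: cvg_inv_bound => k; case: (fP k).
- split => [k|]; first by case: (fP k).
  by apply: cvg_inv_bound => k; rewrite subr0; case: (fP k) => ? ? _ _; rewrite gtr0_norm.
Qed.

Lemma directional_normal_coneI {R : realType} {d : nat} (Omega : set 'rV[R]_d)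
    (z u zs : 'rV[R]_d) :
  (forall e, 0 < e -> exists (t : R) (w ws : 'rV[R]_d),
    [/\ 0 < t < e, `|w - u| < e, `|ws - zs| < e &
        regular_normal_cone Omega (z + t *: w) ws]) ->
  directional_normal_cone Omega z u zs.
Proof.
move=> h.
have hk k : exists tw : R * 'rV[R]_d * 'rV[R]_d, [/\ 0 < tw.1.1 < k.+1%:R^-1,
    `|tw.1.2 - u| < k.+1%:R^-1, `|tw.2 - zs| < k.+1%:R^-1 &
    regular_normal_cone Omega (z + tw.1.1 *: tw.1.2) tw.2].
  by have [|t [w [ws ?]]] := h k.+1%:R^-1; [rewrite invr_gt0|exists (t, w, ws)].
have [f fP] := choice hk.
exists (fun k => (f k).1.1), (fun k => (f k).1.2), (fun k => (f k).2).
split => [|||k]; last by case: (fP k).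
- split => [k|]; first by case: (fP k) => /andP[].
  apply: cvg_inv_bound => k; rewrite subr0.
  by case: (fP k) => /andP[? ?] _ _ _; rewrite gtr0_norm.
- by apply: cvg_inv_bound => k; case: (fP k).
- by apply: cvg_inv_bound => k; case: (fP k).
Qed.

(** Along tangent sequences the quadratic error is [o(t)], so that the linear
    part alone is nonnegative in the limit. *)
Lemma proximal_regular_normal {R : realType} {d : nat} (Omega : set 'rV[R]_d)
    (z g : 'rV[R]_d) (C rho : R) :
  Omega z -> 0 < rho ->
  (forall w, Omega w -> `|w - z| < rho ->
     0 <= dotv g (w - z) + C * dotv (w - z) (w - z)) ->
  regular_normal_cone Omega z (- g).
Proof.
move=> Oz rho0 h; split => // u [w [t [wu [t0 tc] O]]].
rewrite dotvNl oppr_le0.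
have lim1 : (fun k => dotv g (w k) + C * (t k * dotv (w k) (w k))) @ \oo -->
    dotv g u + C * (0 * dotv u u).
  apply: cvgD; first by apply: cvg_dotv => //; exact: cvg_cst.
  by apply: cvgMl_tmp; apply: cvgM => //; exact: cvg_dotv.
rewrite mul0r mulr0 addr0 in lim1.
have tw0 : (fun k => t k *: w k) @ \oo --> (0 : R) *: u by exact: cvgZ.
rewrite scale0r in tw0.
apply: (closed_cvg [set y : R | 0 <= y] _ _ _ lim1); first exact: closed_ge.
have /cvgrPdist_lt/(_ _ rho0) := tw0; apply: filterS => k /=.
rewrite sub0r normrN => small.
have := h _ (O k); rewrite addrC addKr => /(_ small).
rewrite !dotvZr dotvZl (_ : _ + _ =
  t k * (dotv g (w k) + C * (t k * dotv (w k) (w k)))); last by ring.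
by rewrite pmulr_rge0.
Qed.

(** * Regular normals from penalised minimisation *)

Lemma penalty_continuous {R : realType} {l n m : nat} (p' : 'rV[R]_l)
    (xh : 'rV[R]_n) (c : R) :
  continuous (fun z : 'rV[R]_(l + n + m) =>
    enorm (row_mx (lsubmx (lsubmx z) - p') (rsubmx z)) +
    c * dotv (rsubmx (lsubmx z) - xh) (rsubmx (lsubmx z) - xh)).
Proof.
move=> z.
(* an abstract filter [F] is used because the neighbourhood filter of a matrix
   unfolds to a form on which no filter instance is inferred *)
suff cvgF (F : set_system 'rV[R]_(l + n + m)) : Filter F -> F --> z ->
    enorm (row_mx (lsubmx (lsubmx w) - p') (rsubmx w)) +
    c * dotv (rsubmx (lsubmx w) - xh) (rsubmx (lsubmx w) - xh) @[w --> F] -->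
    enorm (row_mx (lsubmx (lsubmx z) - p') (rsubmx z)) +
    c * dotv (rsubmx (lsubmx z) - xh) (rsubmx (lsubmx z) - xh).
  exact: (cvgF (nbhs z) (nbhs_filter z) (@cvg_id _ (nbhs z))).

move=> FF Fz.
have cl : lsubmx (w : 'rV[R]_(l + n + m)) @[w --> F] --> lsubmx z.
  by apply: (cvg_comp _ _ Fz); apply: continuous_lsubmx.
have cr : rsubmx (w : 'rV[R]_(l + n + m)) @[w --> F] --> rsubmx z.
  by apply: (cvg_comp _ _ Fz); apply: continuous_rsubmx.
have cll : lsubmx (lsubmx (w : 'rV[R]_(l + n + m))) - p' @[w --> F] -->
    lsubmx (lsubmx z) - p'.
  apply: cvgB; last exact: cvg_cst.
  by apply: (cvg_comp _ _ cl); apply: continuous_lsubmx.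
have crl : rsubmx (lsubmx (w : 'rV[R]_(l + n + m))) - xh @[w --> F] -->
    rsubmx (lsubmx z) - xh.
  apply: cvgB; last exact: cvg_cst.
  by apply: (cvg_comp _ _ cl); apply: continuous_rsubmx.
apply: cvgD.
  rewrite /enorm; apply: continuous_cvg; first exact: sqrt_continuous.
  rewrite dotv_row_mx; under eq_fun do rewrite dotv_row_mx.
  by apply: cvgD; exact: cvg_dotv.
by apply: cvgMl_tmp; exact: cvg_dotv.
Qed.

(** The minimiser [(pt, xt, yt)] of the penalty
    [|(p - p', y)| + |x - xh|^2 / (L^2 r)] has value at most [r], the value at
    [(ph, xh, yh)].  This confines it to the interior of the truncation, and
    the lack of solutions near [xh] makes the first term nonzero there.  The
    normal is minus the gradient of the penalty. *)
Lemma penalized_projection_normal {R : realType} {l n m : nat}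
    (M : 'rV[R]_(l + n) -> set 'rV[R]_m) (pbar : 'rV[R]_l) (xbar : 'rV[R]_n)
    (rho : R) (ph p' : 'rV[R]_l) (xh : 'rV[R]_n) (yh : 'rV[R]_m) (L : R) :
  let zbar := row_mx (row_mx pbar xbar) (0 : 'rV[R]_m) in
  let r := enorm (row_mx (ph - p') yh) in
  compact (gph M `&` [set w | `|w - zbar| <= rho]) ->
  0 < L -> gph M (row_mx (row_mx ph xh) yh) ->
  `|p' - pbar| + r < rho -> `|xh - xbar| + L * r < rho ->
  (forall x', solution_map M p' x' -> L * r < `|x' - xh|) ->
  exists pt xt yt ps xs ys,
    [/\ `|pt - p'| <= r, `|xt - xh| <= L * r & `|yt| <= r] /\
    [/\ enorm (row_mx ps ys) = 1, `|xs| <= 2 / L &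
        regular_normal_cone (gph M) (row_mx (row_mx pt xt) yt)
          (row_mx (row_mx ps xs) ys)].
Proof.
move=> zbar r cK L0 Mh small_p small_x far.
have r0 : 0 < r.
  rewrite lt_neqAle enorm_ge0 andbT eq_sym; apply/eqP => /[dup] re /enorm_eq0.
  rewrite -[0]row_mx0 => /eq_row_mx[/subr0_eq ep ey].
  have /far : solution_map M p' xh.
    by move: Mh; rewrite /gph /solution_map /= row_mxKl row_mxKr ep ey.
  by rewrite re subrr normr0 mulr0 ltxx.
pose c := (L ^+ 2 * r)^-1.
have c0 : 0 < c by rewrite invr_gt0 mulr_gt0 ?exprn_gt0.
pose phi (p : 'rV[R]_l) (x : 'rV[R]_n) (y : 'rV[R]_m) :=
  enorm (row_mx (p - p') y) + c * dotv (x - xh) (x - xh).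
have rrho : r < rho by apply: le_lt_trans small_p; rewrite lerDr normr_ge0.
have Lr0 : 0 < L * r by rewrite mulr_gt0.
have inK p x y : `|p - p'| <= r -> `|x - xh| <= L * r -> `|y| <= r ->
    `|row_mx (row_mx p x) y - zbar| < rho.
  move=> hp hx hy; rewrite !row_mx_sub !norm_row_mx_lt subr0.
  rewrite (le_lt_trans hy rrho) andbT; apply/andP; split.
    rewrite -(subrK p' p) -addrA; apply: (le_lt_trans (ler_normD _ _)).
    by apply: le_lt_trans small_p; rewrite [leRHS]addrC lerD2r.
  rewrite -(subrK xh x) -addrA; apply: (le_lt_trans (ler_normD _ _)).
  by apply: le_lt_trans small_x; rewrite [leRHS]addrC lerD2r.
have Kh : (gph M `&` [set w | `|w - zbar| <= rho]) (row_mx (row_mx ph xh) yh).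
  have := norm_le_enorm (row_mx (ph - p') yh).
  rewrite norm_row_mx_le => /andP[? ?]; split => //=.
  by apply/ltW/inK => //; rewrite subrr normr0 ltW.
have [|z zK zmin] := EVT_min_rV _ cK
    (continuous_subspaceT (@penalty_continuous R l n m p' xh c)).
  by exists (row_mx (row_mx ph xh) yh).
have {}zmin w : gph M w -> `|w - zbar| <= rho -> _ := fun Ow wr =>
  zmin w (mem_set (conj Ow wr)).
move: zK; rewrite inE => -[Oz zrho].
have [pt [xt [yt ez]]] := row_mx3P z.
rewrite {}ez in Oz zrho zmin.
have {}zmin p x y : gph M (row_mx (row_mx p x) y) ->
    `|row_mx (row_mx p x) y - zbar| <= rho -> phi pt xt yt <= phi p x y.
  by move=> Ow /(zmin _ Ow); rewrite !(row_mxKl, row_mxKr).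
have phih : phi pt xt yt <= r.
  apply: (le_trans (zmin _ _ _ Mh (proj2 Kh))).
  by rewrite /phi subrr dotv0 mulr0 addr0.
pose s0 := enorm (row_mx (pt - p') yt).
have d0 : 0 <= c * dotv (xt - xh) (xt - xh) by rewrite mulr_ge0 ?dotv_ge0 // ltW.
have s0r : s0 <= r by apply: le_trans phih; rewrite lerDl.
have xtr : `|xt - xh| <= L * r.
  apply: (le_trans (norm_le_enorm _)).
  rewrite -(ler_pXn2r (n := 2)) ?nnegrE ?enorm_ge0 ?(ltW Lr0) // sqr_enorm.
  have : c * dotv (xt - xh) (xt - xh) <= r.
    by apply: le_trans phih; rewrite lerDr enorm_ge0.
  rewrite /c mulrC ler_pdivrMr ?mulr_gt0 ?exprn_gt0 // => /le_trans; apply.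
  by rewrite exprMn le_eqVlt; apply/orP; left; apply/eqP; ring.
have s00 : 0 < s0.
  rewrite lt_neqAle enorm_ge0 andbT eq_sym; apply/eqP => /enorm_eq0.
  rewrite -[0]row_mx0 => /eq_row_mx[/subr0_eq ep ey].
  have /far : solution_map M p' xt.
    by move: Oz; rewrite /gph /solution_map /= row_mxKl row_mxKr ep ey.
  by rewrite ltNge xtr.
have [ptr ytr] : `|pt - p'| <= r /\ `|yt| <= r.
  apply/andP; rewrite -norm_row_mx_le.
  exact: le_trans (norm_le_enorm _) s0r.
have zlt := inK _ _ _ ptr xtr ytr.
pose g : 'rV[R]_(l + n + m) :=
  row_mx (row_mx (s0^-1 *: (pt - p')) ((2 * c) *: (xt - xh))) (s0^-1 *: yt).
exists pt, xt, yt, (- (s0^-1 *: (pt - p'))), (- ((2 * c) *: (xt - xh))),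
  (- (s0^-1 *: yt)).
do 2 split => //.
- rewrite -opp_row_mx -scale_row_mx -scaleN1r scalerA.
  rewrite /enorm dotvZl dotvZr -sqr_enorm -/s0.
  rewrite (_ : _ * _ = 1) ?sqrtr1 //; field.
  exact: lt0r_neq0.
- rewrite normrN normrZ gtr0_norm ?mulr_gt0 //.
  apply: (le_trans (ler_wpM2l _ xtr)); first by rewrite mulr_ge0 // ltW.
  rewrite le_eqVlt; apply/orP; left; apply/eqP; rewrite /c; field.
  by rewrite !lt0r_neq0.
rewrite -!opp_row_mx -/g.
apply: (proximal_regular_normal _ _ _ ((2 * s0)^-1 + c)
  (rho - `|row_mx (row_mx pt xt) yt - zbar|)) => //.
  by rewrite subr_gt0.
move=> w; have [p [x [y ->]]] := row_mx3P w => Ow wz.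
have wK : `|row_mx (row_mx p x) y - zbar| <= rho.
  rewrite -(subrK (row_mx (row_mx pt xt) yt) (row_mx (row_mx p x) y)) -addrA.
  apply: (le_trans (ler_normD _ _)); rewrite -lerBrDr; exact: ltW.
have := zmin _ _ _ Ow wK; rewrite /phi -/s0.
rewrite !row_mx_sub /g !dotv_row_mx !dotvZl.
set dp := p - pt; set dx := x - xt; set dy := y - yt.
have -> : p - p' = (pt - p') + dp by rewrite /dp [RHS]addrC addrA subrK.
have -> : x - xh = (xt - xh) + dx by rewrite /dx [RHS]addrC addrA subrK.
have ey : y = yt + dy by rewrite /dy [RHS]addrC subrK.
set s := enorm _.
have s2 : s ^+ 2 = s0 ^+ 2 + 2 * (dotv (pt - p') dp + dotv yt dy)
    + (dotv dp dp + dotv dy dy).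
  by rewrite !sqr_enorm !dotv_row_mx ey (dotv_sqrD (pt - p')) (dotv_sqrD yt); ring.
(* AM-GM: the norm is majorised by a quadratic function that touches it at
   the minimiser *)
have samgm : s <= (s ^+ 2 + s0 ^+ 2) / (2 * s0).
  rewrite ler_pdivlMr ?mulr_gt0 // -subr_ge0.
  by rewrite (_ : _ - _ = (s - s0) ^+ 2) ?sqr_ge0 //; ring.
rewrite (dotv_sqrD (xt - xh) dx) => hmin.
rewrite s2 in samgm.
set A := dotv (pt - p') dp in samgm *; set A' := dotv yt dy in samgm *.
set B := dotv dp dp in samgm *; set B' := dotv dy dy in samgm *.
set D := dotv (xt - xh) dx in hmin *; set E := dotv dx dx in hmin *.
have B0 : 0 <= B by exact: dotv_ge0.
have B'0 : 0 <= B' by exact: dotv_ge0.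
have E0 : 0 <= E by exact: dotv_ge0.
have e1 : (s0 ^+ 2 + 2 * (A + A') + (B + B') + s0 ^+ 2) / (2 * s0) =
    s0 + (s0^-1 * A + s0^-1 * A') + (2 * s0)^-1 * (B + B').
  by field; exact: lt0r_neq0.
rewrite e1 in samgm.
have h1 : 0 <= (2 * s0)^-1 * E by rewrite mulr_ge0 // invr_ge0 ltW // mulr_gt0.
have h2 : 0 <= c * (B + B') by rewrite mulr_ge0 ?addr_ge0 // ltW.
move: hmin samgm h1 h2; set k := (2 * s0)^-1; set i := s0^-1 => hmin samgm h1 h2.
lra.
Qed.

(** * Regularity along one direction *)

(** A directional form of metric regularity of [M] in [x]: the residual of the
    point [(ph, xh, yh)] for the parameter [p'] is [|(ph - p', yh)|], and it
    bounds the distance from [xh] to the solutions at [p']. *)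
Definition regular_in_direction {R : realType} {l n m : nat}
    (M : 'rV[R]_(l + n) -> set 'rV[R]_m) (pbar : 'rV[R]_l) (xbar : 'rV[R]_n)
    (q : 'rV[R]_l) (u : 'rV[R]_n) (eps L : R) : Prop :=
  forall t ph xh yh p', 0 < t < eps -> gph M (row_mx (row_mx ph xh) yh) ->
    `|ph - pbar - t *: q| <= eps * t -> `|xh - xbar - t *: u| <= eps * t ->
    `|yh| <= eps * t -> `|p' - pbar - t *: q| <= eps * t ->
    exists2 x', solution_map M p' x' &
      `|x' - xh| <= L * enorm (row_mx (ph - p') yh).

(** A failure of the estimate for the slope [2 / e] and a tolerance of order
    [e^2] feeds the penalisation.  Its displacement, at most [2 / e] times the
    residual, is then [O(e t)], so the new base point still lies in the
    direction [(q, u, 0)] up to [e]. *)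
Lemma irregular_direction_normals {R : realType} {l n m : nat}
    (M : 'rV[R]_(l + n) -> set 'rV[R]_m) (pbar : 'rV[R]_l) (xbar : 'rV[R]_n)
    (q : 'rV[R]_l) (u : 'rV[R]_n) :
  let zbar := row_mx (row_mx pbar xbar) (0 : 'rV[R]_m) in
  locally_closed_at (gph M) zbar ->
  (forall eps L, 0 < eps -> 0 < L -> ~ regular_in_direction M pbar xbar q u eps L) ->
  forall e, 0 < e -> exists t w ps xs ys,
    [/\ 0 < t < e, `|w - row_mx (row_mx q u) 0| < e,
        enorm (row_mx ps ys) = 1, `|xs| < e &
        regular_normal_cone (gph M) (zbar + t *: w) (row_mx (row_mx ps xs) ys)].
Proof.
move=> zbar /locally_closed_compact[rho rho0 cK] irreg e.
have far eps L : 0 < eps -> 0 < L -> exists t ph xh yh p',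
    [/\ 0 < t < eps, gph M (row_mx (row_mx ph xh) yh),
        `|ph - pbar - t *: q| <= eps * t, `|xh - xbar - t *: u| <= eps * t &
        `|yh| <= eps * t /\ `|p' - pbar - t *: q| <= eps * t] /\
      forall x', solution_map M p' x' ->
        L * enorm (row_mx (ph - p') yh) < `|x' - xh|.
  move=> eps0 L0; apply: contrapT => h; apply: (irreg _ _ eps0 L0).
  move=> t ph xh yh p' ? ? ? ? ? ?; apply: contrapT => h2; apply: h.
  exists t, ph, xh, yh, p'; split => // x' Sx'.
  by rewrite ltNge; apply/negP => h3; apply: h2; exists x'.
move=> e0; pose e1 := Num.min e 1 / 2.
have e10 : 0 < e1 by rewrite divr_gt0 // lt_min e0 ltr01.
have [e1e e11] : e1 < e /\ e1 <= 1.
  have h1 : Num.min e 1 <= e by rewrite ge_min lexx.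
  have h2 : Num.min e 1 <= 1 by rewrite ge_min lexx orbT.
  by rewrite /e1; split; lra.
pose K : R := (l + m)%:R; have K0 : 0 <= K by [].
pose T : R := `|q| + `|u| + 3.
have T0 : 0 < T by rewrite /T ltr_wpDl // addr_ge0.
(* the first bound makes r <= e1 t / 4 and L r <= e1 t / 2 for L = 2 / e1,
   the second keeps the penalisation inside the truncation *)
pose eps := Num.min (e1 ^+ 2 / (8 * K + 8)) (rho / T).
have K8 : 0 < 8 * K + 8 by lra.
have eps0 : 0 < eps by rewrite lt_min !divr_gt0 ?exprn_gt0.
have epsK : eps * (8 * K + 8) <= e1 ^+ 2.
  by rewrite -ler_pdivlMr // /eps ge_min lexx.
have epsT : eps * T <= rho by rewrite -ler_pdivlMr // /eps ge_min lexx orbT.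
have e1sq : e1 ^+ 2 <= e1 by rewrite expr2 ger_pMr.
have epsK0 : 0 <= eps * K by rewrite mulr_ge0 // ltW.
have L0 : 0 < 2 / e1 by rewrite divr_gt0.
have [t [ph [xh [yh [p' [[/andP[t0 te] Mh hp hx [hy hp']] noS]]]]]] :=
  far _ _ eps0 L0.
set r := enorm _ in noS.
have hpp' : `|ph - p'| <= 2 * eps * t.
  have -> : 2 * eps * t = eps * t + eps * t by ring.
  apply: (ler_norm_sub3 _ (pbar + t *: q)); first by rewrite opprD addrA.
  by rewrite distrC opprD addrA.
have et0 : 0 < eps * t by rewrite mulr_gt0.
have rK : r <= K * (2 * eps * t).
  by apply: enorm_row_mx_le => //; apply: (le_trans hy); lra.
have r_small : r <= e1 / 4 * t.
  apply: (le_trans rK); rewrite !mulrA ler_pM2r //; lra.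
have Lr_small : 2 / e1 * r <= e1 / 2 * t.
  rewrite mulrAC ler_pdivrMr //.
  have : 2 * r <= e1 ^+ 2 / 2 * t.
    apply: (le_trans (ler_wpM2l _ rK)) => //.
    by rewrite !mulrA ler_pM2r //; lra.
  by move=> /le_trans; apply; rewrite le_eqVlt; apply/orP; left; apply/eqP; ring.
have epse1 : eps <= e1 / 4 by lra.
have epst : eps * t <= e1 / 4 * t by rewrite ler_pM2r.
have e1t0 : 0 < e1 * t by rewrite mulr_gt0.
have e1t : e1 * t <= t by rewrite ger_pMl.
have tT : t * T < rho by apply: lt_le_trans epsT; rewrite ltr_pM2r.
have small_p : `|p' - pbar| + r < rho.
  have : `|p' - pbar| <= eps * t + t * `|q|.
    rewrite -(subrK (t *: q) (p' - pbar)) (le_trans (ler_normD _ _)) //.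
    by rewrite lerD // normrZ gtr0_norm.
  move: tT; rewrite /T !mulrDr; have := mulr_ge0 (ltW t0) (normr_ge0 u); lra.
have small_x : `|xh - xbar| + 2 / e1 * r < rho.
  have : `|xh - xbar| <= eps * t + t * `|u|.
    rewrite -(subrK (t *: u) (xh - xbar)) (le_trans (ler_normD _ _)) //.
    by rewrite lerD // normrZ gtr0_norm.
  move: tT; rewrite /T !mulrDr; have := mulr_ge0 (ltW t0) (normr_ge0 q); lra.
have [pt [xt [yt [ps [xs [ys [[hpt hxt hyt] [n1 hxs N]]]]]]]] :=
  penalized_projection_normal _ _ _ _ _ _ _ _ _ cK L0 Mh small_p small_x noS.
exists t, (t^-1 *: (row_mx (row_mx pt xt) yt - zbar)), ps, xs, ys; split => //.
- by rewrite t0 /=; apply: (lt_le_trans te); lra.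
- apply: (le_lt_trans _ e1e); rewrite -(ler_pM2r t0) mulrC -[t in t * _]gtr0_norm //.
  rewrite -normrZ scalerBr scalerA divff ?lt0r_neq0 // scale1r.
  rewrite /zbar !row_mx_sub !scale_row_mx row_mx_sub row_mx_sub scaler0 !subr0.
  rewrite !norm_row_mx_le -andbA; apply/and3P; split.
  + rewrite -addrA -opprD; have -> : e1 * t = e1 / 2 * t + e1 / 2 * t by field.
    apply: (ler_norm_sub3 _ p'); first by apply: (le_trans hpt); rewrite -/r; lra.
    by rewrite opprD addrA; apply: (le_trans hp'); lra.
  + rewrite -addrA -opprD; have -> : e1 * t = e1 / 2 * t + e1 / 2 * t by field.
    apply: (ler_norm_sub3 _ xh); first exact: le_trans hxt Lr_small.
    by rewrite opprD addrA; apply: (le_trans hx); lra.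
  + by apply: (le_trans hyt); rewrite -/r; lra.
- by apply: (le_lt_trans hxs); rewrite invf_div mulrA mulrAC divff ?mul1r.
- by rewrite scalerA divff ?lt0r_neq0 // scale1r addrC subrK.
Qed.

(** A cluster point of the normals found at irregular points would be a
    nonzero directional normal with vanishing [x] component. *)
Lemma directional_regularity {R : realType} {l n m : nat}
    (M : 'rV[R]_(l + n) -> set 'rV[R]_m) (pbar : 'rV[R]_l) (xbar : 'rV[R]_n)
    (q : 'rV[R]_l) (u : 'rV[R]_n) :
  locally_closed_at (gph M) (row_mx (row_mx pbar xbar) 0) ->
  (graphical_derivative M (row_mx pbar xbar) 0 (row_mx q u) 0 ->
   forall (qs : 'rV[R]_l) (vs : 'rV[R]_m),
     directional_coderivative M (row_mx pbar xbar) 0 (row_mx q u) 0 vs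
       (row_mx qs 0) -> qs = 0 /\ vs = 0) ->
  exists eps L : R, [/\ 0 < eps, 0 < L &
    regular_in_direction M pbar xbar q u eps L].
Proof.
move=> hlc hii; apply: contrapT => nex.
have claim := irregular_direction_normals M pbar xbar q u hlc
  (fun eps L eps0 L0 reg => nex (ex_intro _ eps (ex_intro _ L (And3 eps0 L0 reg)))).
pose zbar := row_mx (row_mx pbar xbar) (0 : 'rV[R]_m).
have tan : graphical_derivative M (row_mx pbar xbar) 0 (row_mx q u) 0.
  apply/tangent_coneP => e /claim[t [w [_ [_ [_ [/andP[t0 te] wz _ _ [Ow _]]]]]]].
  by exists t, w.
have seqk k : exists f : R * 'rV[R]_(l + n + m) * 'rV[R]_l * 'rV[R]_n * 'rV[R]_m,
    let: (t, w, ps, xs, ys) := f in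
    [/\ 0 < t < k.+1%:R^-1, `|w - row_mx (row_mx q u) 0| < k.+1%:R^-1,
        enorm (row_mx ps ys) = 1, `|xs| < k.+1%:R^-1 &
        regular_normal_cone (gph M) (zbar + t *: w) (row_mx (row_mx ps xs) ys)].
  have [|t [w [ps [xs [ys ?]]]]] := claim k.+1%:R^-1; first by rewrite invr_gt0.
  by exists (t, w, ps, xs, ys).
have [f fP] := choice seqk.
have [|v0 v01 clv] := unit_sphere_cluster
    (fun k => let: (t, w, ps, xs, ys) := f k in row_mx ps ys).
  by move=> k; have := fP k; case: (f k) => [[[[t w] ps] xs] ys] [].
have ev0 : v0 = row_mx (lsubmx v0) (rsubmx v0) by rewrite hsubmxK.
have [] := hii tan (lsubmx v0) (- rsubmx v0).
  (* the coderivative changes the sign of the y component *)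
  rewrite /directional_coderivative /= opprK.
  apply: directional_normal_coneI => e e0.
  have [N HN] := exists_inv_lt _ e0.
  have [k /HN ke] := clv e N e0.
  have := fP k; case: (f k) => [[[[t w] ps] xs] ys].
  move=> [/andP[t0 tk] wk _ xsk Nk' ve].
  exists t, w, (row_mx (row_mx ps xs) ys); split => //.
  - by rewrite t0 (lt_trans tk).
  - exact: lt_trans wk ke.
  - move: ve; rewrite {1}ev0 !row_mx_sub !norm_row_mx_lt subr0 => /andP[-> ->].
    by rewrite (lt_trans xsk).
move=> l0 /eqP; rewrite oppr_eq0 => /eqP r0'.
move: v01; rewrite ev0 l0 r0' row_mx0 /enorm dotv0 sqrtr0 => /eqP.
by rewrite eq_sym oner_eq0.
Qed.

(** * Regularity uniform in the direction *)

(** Here [t] is read off from the point of the graph, so that one pair of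
    constants serves all directions. *)
Definition regular_around {R : realType} {l n m : nat}
    (M : 'rV[R]_(l + n) -> set 'rV[R]_m) (P : set 'rV[R]_l)
    (pbar : 'rV[R]_l) (xbar : 'rV[R]_n) (eps L : R) : Prop :=
  forall ph xh yh p', let t := enorm (row_mx (ph - pbar) (xh - xbar)) in
    0 < t < eps -> gph M (row_mx (row_mx ph xh) yh) -> P p' ->
    `|yh| <= eps * t -> `|p' - ph| <= eps * t ->
    exists2 x', solution_map M p' x' &
      `|x' - xh| <= L * enorm (row_mx (ph - p') yh).

(** Failures of the estimate at every scale have directions on the unit sphere;
    at a cluster point [(q, u)] of these directions the directional estimate
    is contradicted.  The parameters [p'] in [P] are within [o(t)] of [ph], hence
    they show that [q] is tangent to [P]. *)
Lemma uniform_regularity {R : realType} {l n m : nat}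
    (M : 'rV[R]_(l + n) -> set 'rV[R]_m) (pbar : 'rV[R]_l) (xbar : 'rV[R]_n)
    (P : set 'rV[R]_l) :
  locally_closed_at (gph M) (row_mx (row_mx pbar xbar) 0) ->
  (forall (q : 'rV[R]_l) (u : 'rV[R]_n),
     tangent_cone P pbar q -> (q, u) <> (0, 0) ->
     graphical_derivative M (row_mx pbar xbar) 0 (row_mx q u) 0 ->
     forall (qs : 'rV[R]_l) (vs : 'rV[R]_m),
       directional_coderivative M (row_mx pbar xbar) 0 (row_mx q u) 0 vs
         (row_mx qs 0) -> qs = 0 /\ vs = 0) ->
  exists eps L : R, [/\ 0 < eps, 0 < L &
    regular_around M P pbar xbar eps L].
Proof.
move=> hlc hii; apply: contrapT => nex.
pose bad (eps : R) (z : 'rV[R]_l * 'rV[R]_n * 'rV[R]_m * 'rV[R]_l) :=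
  let: (ph, xh, yh, p') := z in
  let t := enorm (row_mx (ph - pbar) (xh - xbar)) in
  [/\ 0 < t < eps, gph M (row_mx (row_mx ph xh) yh), P p',
      `|yh| <= eps * t /\ `|p' - ph| <= eps * t &
      forall x', solution_map M p' x' ->
        eps^-1 * enorm (row_mx (ph - p') yh) < `|x' - xh|].
have far k : exists z, bad k.+1%:R^-1 z.
  apply: contrapT => h; apply: nex; exists k.+1%:R^-1, k.+1%:R; split=> //.
  move=> ph xh yh p' t ht ? ? ? ?; apply: contrapT => h2; apply: h.
  exists (ph, xh, yh, p'); split => // x' Sx'; rewrite invrK.
  by rewrite ltNge; apply/negP => h3; apply: h2; exists x'.
have [f fP] := choice far.
have [|w0 w01 clw] := unit_sphere_cluster (fun k => let: (ph, xh, yh, p') := f k in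
    (enorm (row_mx (ph - pbar) (xh - xbar)))^-1 *: row_mx (ph - pbar) (xh - xbar)).
  move=> k; have := fP k; case: (f k) => [[[ph xh] yh] p'] [/andP[t0 _] _ _ _ _].
  by rewrite enormZ ?invr_ge0 ?ltW // mulVf // lt0r_neq0.
pose q := lsubmx w0; pose u := rsubmx w0.
have ew : w0 = row_mx q u by rewrite hsubmxK.
have near_dir e : 0 < e -> exists t ph xh yh p',
    [/\ 0 < t < e, gph M (row_mx (row_mx ph xh) yh), P p',
        [/\ `|ph - pbar - t *: q| <= e * t, `|xh - xbar - t *: u| <= e * t,
            `|yh| <= e * t & `|p' - pbar - t *: q| <= e * t] &
        forall x', solution_map M p' x' ->
          e^-1 * enorm (row_mx (ph - p') yh) < `|x' - xh|].
  move=> e0; have e20 : 0 < e / 2 by rewrite divr_gt0.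
  have [N HN] := exists_inv_lt _ e20.
  have [k /HN ke] := clw _ N e20.
  have := fP k; case: (f k) => [[[ph xh] yh] p'].
  set ek := k.+1%:R^-1 in ke *.
  have ek0 : 0 < ek by rewrite invr_gt0.
  rewrite /bad; set t := enorm _.
  move=> [/andP[t0 tk] Mh Pp' [hy hp'] hS] hw.
  have ekt : ek * t <= e / 2 * t by rewrite ler_pM2r // ltW.
  have ehalf : e * t = e / 2 * t + e / 2 * t by field.
  have e2t : 0 <= e / 2 * t by rewrite mulr_ge0 // ltW.
  move: hw; rewrite ew => /ltW; rewrite -(ler_pM2r t0) mulrC.
  rewrite -{1}[t]gtr0_norm // -normrZ scalerBr scalerA divff ?lt0r_neq0 // scale1r.
  rewrite scale_row_mx row_mx_sub norm_row_mx_le => /andP[hq hu].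
  exists t, ph, xh, yh, p'; split => //.
  - by rewrite t0; lra.
  - rewrite ehalf; split.
    + by apply: (le_trans hq); rewrite lerDl.
    + by apply: (le_trans hu); rewrite lerDl.
    + by apply: (le_trans hy); lra.
    + rewrite -addrA -opprD; apply: (ler_norm_sub3 _ ph).
        exact: le_trans hp' ekt.
      by rewrite opprD addrA.
  - move=> x' /hS; apply: le_lt_trans; rewrite ler_wpM2r ?enorm_ge0 //.
    by rewrite lef_pV2 ?posrE //; lra.
have Tq : tangent_cone P pbar q.
  apply/tangent_coneP => e e0.
  have e20 : 0 < e / 2 by rewrite divr_gt0.
  have [t [ph [xh [yh [p' [/andP[t0 te] _ Pp' [_ _ _ hp'] _]]]]]] := near_dir _ e20.
  exists t, (t^-1 *: (p' - pbar)); split => //; first by lra.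
    have : `|t^-1 *: (p' - pbar) - q| <= e / 2; last by lra.
    rewrite -(ler_pM2r t0) mulrC -{1}[t]gtr0_norm // -normrZ scalerBr scalerA.
    by rewrite divff ?lt0r_neq0 // scale1r.
  by rewrite scalerA divff ?lt0r_neq0 // scale1r addrC subrK.
have nz : (q, u) <> (0, 0).
  case=> q0 u0; move: w01; rewrite ew q0 u0 row_mx0 /enorm dotv0 sqrtr0 => /eqP.
  by rewrite eq_sym oner_eq0.
have [eps [L [eps0 L0 reg]]] :=
  directional_regularity M pbar xbar q u hlc (hii q u Tq nz).
(* the slope e^-1 excluded by near_dir exceeds L *)
pose e := Num.min eps L^-1.
have e0 : 0 < e by rewrite lt_min eps0 invr_gt0.
have eeps : e <= eps by rewrite ge_min lexx.
have eL : L <= e^-1 by rewrite -[L]invrK lef_pV2 ?posrE ?invr_gt0 // ge_min lexx orbT.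
have [t [ph [xh [yh [p' [/andP[t0 te] Mh Pp' [h1 h2 h3 h4] hS]]]]]] := near_dir _ e0.
have et : e * t <= eps * t by rewrite ler_pM2r.
have [|||||x' /hS Sx' hx'] := reg t ph xh yh p' _ Mh.
- by rewrite t0 (lt_le_trans te).
- exact: le_trans et.
- exact: le_trans et.
- exact: le_trans et.
- exact: le_trans et.
move: (lt_le_trans Sx' hx'); rewrite ltNge ler_wpM2r //; exact: enorm_ge0.
Qed.

(** * Solutions close to the reference point *)

(** Lipschitz lower semicontinuity of the solution map at the reference point,
    relative to [P]. *)
Definition lipschitz_lsc_at {R : realType} {l n m : nat}
    (M : 'rV[R]_(l + n) -> set 'rV[R]_m) (P : set 'rV[R]_l)
    (pbar : 'rV[R]_l) (xbar : 'rV[R]_n) (delta L' : R) : Prop :=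
  forall p', P p' -> enorm (p' - pbar) < delta ->
    exists2 x', solution_map M p' x' & `|x' - xbar| <= L' * `|p' - pbar|.

(** If solutions close to [xbar] are missing along some [p'] tending to [pbar],
    let [q] be a limit direction of these parameters and [t = |p' - pbar|].
    Hypothesis (i) supplies points of [gph M] within [o(t)] of
    [(pbar + t q, xbar + t u, 0)].  As [q] is nonzero, their distance to the
    reference point is of order [t], so the uniform estimate applies and yields
    solutions at distance [O(t)] from [xbar]. *)
Lemma solution_near_reference {R : realType} {l n m : nat}
    (M : 'rV[R]_(l + n) -> set 'rV[R]_m) (pbar : 'rV[R]_l) (xbar : 'rV[R]_n)
    (P : set 'rV[R]_l) (eps L : R) :
  gph M (row_mx (row_mx pbar xbar) 0) ->
  (forall (q : 'rV[R]_l) (t : nat -> R),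
     tangent_cone P pbar q -> decr_to0 t ->
     exists u : 'rV[R]_n,
       limn_einf (fun k =>
         (dist (row_mx (row_mx (pbar + t k *: q) (xbar + t k *: u)) 0)
               (gph M) / t k)%:E) = 0%E) ->
  0 < eps -> 0 < L ->
  regular_around M P pbar xbar eps L ->
  exists delta L' : R, [/\ 0 < delta, 0 < L' &
    lipschitz_lsc_at M P pbar xbar delta L'].
Proof.
move=> Mbar hi eps0 L0 reg; apply: contrapT => nex.
pose bad (e : R) (p' : 'rV[R]_l) := [/\ P p', 0 < enorm (p' - pbar) < e &
  forall x', solution_map M p' x' -> e^-1 * `|p' - pbar| < `|x' - xbar|].
have bad_mono e e' p' : 0 < e -> e <= e' -> bad e p' -> bad e' p'.
  move=> e0 ee' [Pp' /andP[t0 te] hS]; split => //.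
    by rewrite t0 (lt_le_trans te).
  move=> x' /hS; apply: le_lt_trans; rewrite ler_wpM2r //.
  by rewrite lef_pV2 // posrE // (lt_le_trans e0).
have far k : exists p', bad k.+1%:R^-1 p'.
  apply: contrapT => h; apply: nex; exists k.+1%:R^-1, k.+1%:R; split => //.
  move=> p' Pp' te; apply: contrapT => h2; apply: h; exists p'.
  have hS x' : solution_map M p' x' -> k.+1%:R * `|p' - pbar| < `|x' - xbar|.
    by move=> Sx'; rewrite ltNge; apply/negP => h3; apply: h2; exists x'.
  split => //; last by move=> x' /hS; rewrite invrK.
  rewrite te andbT; apply: enorm_gt0 => /subr0_eq ep; apply: h2.
  exists xbar; last by rewrite subrr normr0 mulr_ge0.
  by move: Mbar; rewrite ep /gph /solution_map /= row_mxKl row_mxKr.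
have [f fP] := choice far.
have [|q q1 clq] := unit_sphere_cluster
    (fun k => (enorm (f k - pbar))^-1 *: (f k - pbar)).
  move=> k; have [_ /andP[t0 _] _] := fP k.
  by rewrite enormZ ?invr_ge0 ?ltW // mulVf // lt0r_neq0.
have near_dir e : 0 < e -> exists p', bad e p' /\
    let t := enorm (p' - pbar) in `|p' - pbar - t *: q| <= e * t.
  move=> e0; have [N HN] := exists_inv_lt _ e0.
  have [k /HN ke hw] := clq _ N e0.
  exists (f k); split; first by apply: bad_mono (fP k) => //; exact: ltW.
  have [_ /andP[t0 _] _] := fP k.
  move: hw => /ltW; rewrite -(ler_pM2r t0) mulrC.
  by rewrite -{1}[enorm _]gtr0_norm // -normrZ scalerBr scalerA divff ?lt0r_neq0 // scale1r.
have Tq : tangent_cone P pbar q.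
  apply/tangent_coneP => e e0.
  have e20 : 0 < e / 2 by rewrite divr_gt0.
  have [p' [[Pp' /andP[t0 te] _] /= hp']] := near_dir _ e20.
  set t := enorm _ in t0 te hp'.
  exists t, (t^-1 *: (p' - pbar)); split => //; first by lra.
    have : `|t^-1 *: (p' - pbar) - q| <= e / 2; last by lra.
    rewrite -(ler_pM2r t0) mulrC -{1}[t]gtr0_norm // -normrZ scalerBr scalerA.
    by rewrite divff ?lt0r_neq0 // scale1r.
  by rewrite scalerA divff ?lt0r_neq0 // scale1r addrC subrK.
have seqk k : exists p', bad k.+1%:R^-1 p' /\
    let t := enorm (p' - pbar) in `|p' - pbar - t *: q| <= k.+1%:R^-1 * t.
  by apply: near_dir; rewrite invr_gt0.
have [g gP] := choice seqk.
pose t k := enorm (g k - pbar).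
have t0 : decr_to0 t.
  split => [k|]; first by have [[_ /andP[]]] := gP k.
  apply: cvg_inv_bound => k; rewrite subr0 ger0_norm ?enorm_ge0 //.
  by have [[_ /andP[]]] := gP k.
(* the parameters g k are chosen first, so that (i) can be applied to the
   very sequence of their distances to pbar *)
have [u hu] := hi q t Tq t0.
pose c := `|q|.
have c0 : 0 < c.
  rewrite normr_gt0; apply/eqP => q0; move: q1.
  by rewrite q0 /enorm dotv0 sqrtr0 => /eqP; rewrite eq_sym oner_eq0.
pose K : R := (l + n)%:R; pose K' : R := (l + m)%:R.
have K0 : 0 <= K by []. have K'0 : 0 <= K' by [].
pose B := c + `|u| + 1; have B0 : 0 < B by rewrite /B ltr_wpDl // addr_ge0 // ltW.
(* d: tolerance for the approximation of (i), small compared with the lower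
   bound c t / 2 for the distance from ph to pbar; C t bounds |x' - xbar| *)
pose d := Num.min (Num.min 1 (c / 2)) (eps * c / 4).
have d0 : 0 < d by rewrite !lt_min ltr01 divr_gt0 // divr_gt0 // mulr_gt0.
have [d1 dc dec] : [/\ d <= 1, d <= c / 2 & d <= eps * c / 4].
  by split; rewrite /d !ge_min lexx ?orbT.
pose C := 2 * L * K' + `|u| + 1.
have C0 : 0 < C by rewrite /C ltr_wpDl // addr_ge0 // !mulr_ge0 // ltW.
pose e := Num.min (Num.min d (eps / (K * B + 1))) (c / (2 * C)).
have KB0 : 0 < K * B + 1 by rewrite ltr_wpDl // mulr_ge0 // ltW.
have e0 : 0 < e by rewrite 2!lt_min d0 divr_gt0 // divr_gt0 // mulr_gt0.
have [ed eB eC] : [/\ e <= d, e <= eps / (K * B + 1) & e <= c / (2 * C)].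
  by split; rewrite /e 2!ge_min lexx ?orbT.
have [N HN] := exists_inv_lt _ e0.
have [k /HN ke hk] := limn_einf0_lt _ hu _ N d0.
have k0 : 0 < k.+1%:R^-1 :> R by rewrite invr_gt0.
have [/(bad_mono _ e _ k0 (ltW ke))[Pp' /andP[tk0 tke] hS] hp'] := gP k.
rewrite -/(t k) in tk0 tke hp'; set p' := g k in Pp' hS hp'; set tk := t k in tk0 tke hp' hk.
move: hk; rewrite ltr_pdivrMr // => /(dist_lt _ _ _ _ Mbar)[w].
have [ph [xh [yh ->]]] := row_mx3P w => Mh.
move=> /(le_lt_trans (norm_le_enorm _)) /ltW.
rewrite !row_mx_sub !norm_row_mx_le sub0r normrN -andbA => /and3P[hph hxh hy].
have {}hp' : `|p' - pbar - tk *: q| <= d * tk.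
  by apply: (le_trans hp'); rewrite ler_pM2r // (le_trans (ltW ke)).
have dtk : d * tk <= tk by rewrite ger_pMl.
have dtk2 : d * tk <= c / 2 * tk by rewrite ler_pM2r.
have cB p1 : `|p1 - pbar - tk *: q| <= d * tk -> c / 2 * tk <= `|p1 - pbar|.
  move=> h; have : c * tk <= `|p1 - pbar| + d * tk; last by lra.
  rewrite -[tk in c * tk]gtr0_norm // mulrC -normrZ.
  rewrite -(subrK (p1 - pbar) (tk *: q)) addrC (le_trans (ler_normD _ _)) //.
  by rewrite lerD2l distrC.
have hph' : `|ph - pbar - tk *: q| <= d * tk by rewrite -addrA -opprD distrC.
have hxh' : `|xh - xbar - tk *: u| <= d * tk by rewrite -addrA -opprD distrC.
have phB : `|ph - pbar| <= tk * B.
  rewrite -(subrK (tk *: q) (ph - pbar)) (le_trans (ler_normD _ _)) // normrZ gtr0_norm //.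
  rewrite /B !mulrDr mulr1; have := mulr_ge0 (ltW tk0) (normr_ge0 u).
  by rewrite -/c; lra.
have xhu : `|xh - xbar| <= tk * (`|u| + 1).
  rewrite -(subrK (tk *: u) (xh - xbar)) (le_trans (ler_normD _ _)) // normrZ gtr0_norm //.
  by rewrite !mulrDr mulr1; lra.
have xhB : `|xh - xbar| <= tk * B.
  by apply: (le_trans xhu); rewrite ler_pM2l // /B; lra.
have pp' : `|p' - ph| <= 2 * d * tk.
  have -> : 2 * d * tk = d * tk + d * tk by ring.
  apply: (ler_norm_sub3 _ (pbar + tk *: q)); first by rewrite opprD addrA.
  by rewrite distrC opprD addrA.
have ctk : 0 < c / 2 * tk by rewrite mulr_gt0 // divr_gt0.
have ct' : c / 2 * tk <= enorm (row_mx (ph - pbar) (xh - xbar)).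
  by apply: le_trans (norm_le_enorm _); rewrite norm_row_mx le_max cB.
have dt' : 2 * d * tk <= eps * enorm (row_mx (ph - pbar) (xh - xbar)).
  apply: le_trans (ler_wpM2l (ltW eps0) ct').
  by rewrite !mulrA ler_pM2r //; lra.
have dtk0 : 0 < d * tk by rewrite mulr_gt0.
have [|||x' /hS far' hx'] := reg ph xh yh p' _ Mh Pp'.
- rewrite (lt_le_trans ctk ct') /=.
  have : enorm (row_mx (ph - pbar) (xh - xbar)) <= K * (tk * B).
    exact: enorm_row_mx_le.
  have : tk * (K * B + 1) < eps.
    by rewrite -ltr_pdivlMr //; apply: lt_le_trans eB.
  by lra.
- by apply: le_trans dt'; lra.
- exact: le_trans dt'.
have : `|x' - xbar| <= tk * C.
  have -> : tk * C = L * (K' * (2 * tk)) + tk * (`|u| + 1) by rewrite /C; ring.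
  apply: (ler_norm_sub3 _ xh) => //; apply: (le_trans hx').
  rewrite ler_wpM2l //; first exact: ltW.
  apply: enorm_row_mx_le; last by apply: (le_trans hy); lra.
  by rewrite distrC; apply: (le_trans pp'); lra.
apply/negP; rewrite -ltNge; apply: le_lt_trans far'.
have cp' : c / 2 * tk <= `|p' - pbar| by exact: cB.
rewrite ler_pdivlMr ?mulr_gt0 // in eC.
rewrite [leRHS]mulrC ler_pdivlMr //; apply: le_trans cp'.
have : tk * (e * (2 * C)) <= tk * c by rewrite ler_pM2l.
lra.
Qed.

(** * Aubin property and graphical derivative of the solution map *)

(** Given [x] in [S p], let [t] be the distance from [(p, x)] to [(pbar, xbar)].
    If [|p' - p|] is small compared with [t], the uniform estimate applies at
    [(p, x, 0)].  Otherwise [t] is bounded by a multiple of [|p' - p|], and a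
    solution at [p'] close to [xbar] is close enough to [x]. *)
Lemma aubin_relativeI {R : realType} {l n m : nat}
    (M : 'rV[R]_(l + n) -> set 'rV[R]_m) (P : set 'rV[R]_l)
    (pbar : 'rV[R]_l) (xbar : 'rV[R]_n) (eps L delta L' : R) :
  0 < eps -> 0 < L ->
  regular_around M P pbar xbar eps L ->
  0 < delta -> 0 < L' ->
  lipschitz_lsc_at M P pbar xbar delta L' ->
  aubin_relative (solution_map M) P pbar xbar.
Proof.
move=> eps0 L0 reg delta0 L'0 ref.
pose K : R := (l + n)%:R; have K0 : 0 <= K by [].
pose Kl : R := l%:R; have Kl0 : 0 <= Kl by [].
have K1 : 0 < K + 1 by lra. have Kl1 : 0 < Kl + 1 by lra.
pose eta := Num.min (eps / (K + 1)) (delta / (Kl + 1)).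
have eta0 : 0 < eta by rewrite lt_min !divr_gt0.
have [etaK etaKl] : eta <= eps / (K + 1) /\ eta <= delta / (Kl + 1).
  by split; rewrite /eta ge_min lexx ?orbT.
rewrite !ler_pdivlMr // in etaK etaKl.
pose L1 := L + L' * (1 + eps^-1) + eps^-1.
have i0 : 0 < eps^-1 by rewrite invr_gt0.
have L10 : 0 <= L1 by rewrite /L1 !addr_ge0 ?mulr_ge0 ?addr_ge0 // ltW.
exists (ball pbar eta), (ball xbar eta), (n%:R * L1); split.
- exact: nbhsx_ballx.
- exact: nbhsx_ballx.
- by rewrite mulr_ge0.
move=> p p' [Pp pV] [Pp' pV'] x [Sx xU].
rewrite -!ball_normE /= in pV pV' xU.
rewrite distrC in pV; rewrite distrC in pV'; rewrite distrC in xU.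
suff [x' Sx' hx'] : exists2 x', solution_map M p' x' &
    `|x' - x| <= L1 * enorm (p - p').
  have [|b b1 eb] := scaled_unit_ball (x - x') (n%:R * L1 * enorm (p - p')).
    by apply: (le_trans (enorm_le_norm _)); rewrite -mulrA ler_wpM2l // distrC.
  by exists x' => //; exists b => //; rewrite -eb addrC subrK.
set r := enorm (p - p'); have r0 : 0 <= r by exact: enorm_ge0.
have pr : `|p' - p| <= r by rewrite distrC; exact: norm_le_enorm.
set t := enorm (row_mx (p - pbar) (x - xbar)).
have t0 : 0 <= t by exact: enorm_ge0.
have tU : `|p - pbar| <= t /\ `|x - xbar| <= t.
  by apply/andP; rewrite -norm_row_mx_le; exact: norm_le_enorm.
have h1 : 0 <= L' * (1 + eps^-1) * r by rewrite mulr_ge0 // mulr_ge0 ?addr_ge0 // ltW.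
have h2 : 0 <= eps^-1 * r by rewrite mulr_ge0 // ltW.
have h3 : 0 <= L * r by rewrite mulr_ge0 // ltW.
(* the second regime includes t = 0, where p = pbar and x = xbar *)
have [/andP[tp rt]|ht] : (0 < t) && (`|p' - p| <= eps * t) \/ eps * t <= `|p' - p|.
  have [tp|tn] := ltP 0 t.
    by have [?|/ltW ?] := leP `|p' - p| (eps * t); [left|right].
  by right; rewrite (@le_anti _ _ t 0) ?t0 ?tn ?mulr0.
- have [||||x' Sx' hx'] := reg p x 0 p' _ _ Pp'.
  + rewrite tp /=; apply: (@le_lt_trans _ _ (K * eta)).
      by apply: enorm_row_mx_le; exact: ltW.
    by apply: lt_le_trans etaK; rewrite mulrDr mulr1 mulrC ltrDl.
  + by move: Sx; rewrite /gph /solution_map /= row_mxKl row_mxKr.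
  + by rewrite normr0 mulr_ge0 // ltW.
  + exact: rt.
  exists x' => //; apply: (le_trans hx').
  by rewrite enorm_row_mx0 -/r /L1 !mulrDl; lra.
have tr : t <= eps^-1 * r by rewrite ler_pdivlMl // (le_trans ht).
have [|x' Sx' hx'] := ref p' Pp'.
  apply: (le_lt_trans (enorm_le_norm _)); apply: lt_le_trans etaKl.
  rewrite mulrC; apply: (@le_lt_trans _ _ (eta * Kl)).
    by rewrite ler_wpM2r // ltW.
  by rewrite mulrDr mulr1 ltrDl.
exists x' => //.
have pp : `|p' - pbar| <= r + eps^-1 * r.
  by apply: (ler_norm_sub3 _ p) => //; case: tU => /le_trans ->.
have : `|x' - x| <= L' * (r + eps^-1 * r) + eps^-1 * r.
  apply: (ler_norm_sub3 _ xbar).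
    by apply: (le_trans hx'); rewrite ler_pM2l.
  by rewrite distrC; case: tU => _ /le_trans ->.
by move=> /le_trans; apply; rewrite /L1 !mulrDl; lra.
Qed.

Lemma gph_solution_map {R : realType} {l n m : nat}
    (M : 'rV[R]_(l + n) -> set 'rV[R]_m) (z : 'rV[R]_(l + n)) :
  gph (solution_map M) z = gph M (row_mx z 0).
Proof. by rewrite /gph /solution_map /= hsubmxK row_mxKl row_mxKr. Qed.

Lemma graphical_derivative_solution_sub {R : realType} {l n m : nat}
    (M : 'rV[R]_(l + n) -> set 'rV[R]_m) (pbar q : 'rV[R]_l) (xbar u : 'rV[R]_n) :
  graphical_derivative (solution_map M) pbar xbar q u ->
  graphical_derivative M (row_mx pbar xbar) 0 (row_mx q u) 0.
Proof.
move=> /tangent_coneP h; apply/tangent_coneP => e e0.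
have [t [w [t0 te wz]]] := h e e0; rewrite gph_solution_map => Mw.
exists t, (row_mx w 0); split => //.
  by rewrite row_mx_sub subrr norm_row_mx_lt wz normr0.
by rewrite scale_row_mx add_row_mx scaler0 addr0.
Qed.

(** The tangent point [(ph, xh, yh)] has [yh = o(t)]; keeping the parameter
    [p' = ph], the estimate moves [xh] by [O(|yh|)] to a solution, which does
    not change the direction. *)
Lemma graphical_derivative_solution_sup {R : realType} {l n m : nat}
    (M : 'rV[R]_(l + n) -> set 'rV[R]_m) (pbar q : 'rV[R]_l) (xbar u : 'rV[R]_n)
    (eps L : R) :
  0 < eps -> 0 < L ->
  regular_in_direction M pbar xbar q u eps L ->
  graphical_derivative M (row_mx pbar xbar) 0 (row_mx q u) 0 ->
  graphical_derivative (solution_map M) pbar xbar q u.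
Proof.
move=> eps0 L0 reg /tangent_coneP h; apply/tangent_coneP => e e0.
pose K : R := (l + m)%:R; have K0 : 0 <= K by [].
have LK : 0 < 2 * (L * K + 1) by rewrite mulr_gt0 // ltr_wpDl // mulr_ge0 // ltW.
pose d := Num.min eps (e / (2 * (L * K + 1))).
have d0 : 0 < d by rewrite lt_min eps0 divr_gt0.
have [deps de] : d <= eps /\ d <= e / (2 * (L * K + 1)).
  by split; rewrite /d ge_min lexx ?orbT.
have de2 : d * (L * K + 1) <= e / 2.
  by move: de; rewrite ler_pdivlMr // mulrCA => ?; lra.
have LKd : 0 <= d * (L * K) by rewrite !mulr_ge0 // ltW.
have [t [w [t0 td wz]]] := h d d0.
have [wq [wu [wy ew]]] := row_mx3P w; move: wz; rewrite {}ew.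
rewrite !row_mx_sub !norm_row_mx_lt subr0 -andbA => /and3P[hq hu hy].
rewrite !scale_row_mx !add_row_mx add0r => Mw.
have scale (V : normedModType R) (v v' : V) : `|v' - v| < d -> forall z,
    `|z + t *: v' - z - t *: v| <= eps * t.
  move=> vd z; rewrite [z + _]addrC addrK -scalerBr normrZ gtr0_norm // mulrC.
  by rewrite ler_pM2r // ltW // (lt_le_trans vd).
have [|||||x' Sx' hx'] := reg t _ _ _ (pbar + t *: wq) _ Mw.
- by rewrite t0 (lt_le_trans td).
- exact: scale.
- exact: scale.
- by rewrite normrZ gtr0_norm // mulrC ler_pM2r // ltW // (lt_le_trans hy).
- exact: scale.
have {}hx' : `|x' - (xbar + t *: wu)| <= d * (L * K) * t.
  apply: (le_trans hx'); rewrite subrr.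
  have -> : d * (L * K) * t = L * (K * (d * t)) by ring.
  rewrite ler_wpM2l ?(ltW L0) //; apply: enorm_row_mx_le.
    by rewrite normr0 mulr_ge0 // ltW.
  by rewrite normrZ gtr0_norm // mulrC ler_pM2r // ltW.
exists t, (row_mx wq (t^-1 *: (x' - xbar))); split => //; first by lra.
  rewrite row_mx_sub norm_row_mx_lt; apply/andP; split; first by lra.
  have -> : t^-1 *: (x' - xbar) - u = t^-1 *: (x' - (xbar + t *: wu)) + (wu - u).
    have -> : x' - (xbar + t *: wu) = x' - xbar - t *: wu by rewrite opprD addrA.
    rewrite [in RHS]scalerBr scalerA mulVf ?lt0r_neq0 // scale1r.
    by rewrite addrA subrK.
  apply: (le_lt_trans (ler_normD _ _)).
  have : `|t^-1 *: (x' - (xbar + t *: wu))| <= d * (L * K).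
    by rewrite normrZ gtr0_norm ?invr_gt0 // ler_pdivrMl // mulrC.
  by lra.
rewrite scale_row_mx add_row_mx scalerA divff ?lt0r_neq0 // scale1r.
rewrite [xbar + _]addrC subrK gph_solution_map.
by move: Sx'; rewrite /solution_map /gph /= row_mxKl row_mxKr.
Qed.

Theorem theorem3p5 (R : realType) (l n m : nat)
    (M : 'rV[R]_(l + n) -> set 'rV[R]_m)
    (pbar : 'rV[R]_l) (xbar : 'rV[R]_n) (P : set 'rV[R]_l)
    (hgph : gph M (row_mx (row_mx pbar xbar) 0))
    (hlc : locally_closed_at (gph M) (row_mx (row_mx pbar xbar) 0))
    (hPclosed : closed P) (hP : P pbar)
    (hi : forall (q : 'rV[R]_l) (t : nat -> R),
       tangent_cone P pbar q -> decr_to0 t ->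
       exists u : 'rV[R]_n,
         limn_einf (fun k =>
           (dist (row_mx (row_mx (pbar + t k *: q) (xbar + t k *: u)) 0)
                 (gph M) / t k)%:E) = 0%E)
    (hii : forall (q : 'rV[R]_l) (u : 'rV[R]_n),
       tangent_cone P pbar q -> (q, u) <> (0, 0) ->
       graphical_derivative M (row_mx pbar xbar) 0 (row_mx q u) 0 ->
       forall (qs : 'rV[R]_l) (vs : 'rV[R]_m),
         directional_coderivative M (row_mx pbar xbar) 0 (row_mx q u) 0 vs
           (row_mx qs 0) ->
         qs = 0 /\ vs = 0) :
  aubin_relative (solution_map M) P pbar xbar /\
  forall q : 'rV[R]_l, tangent_cone P pbar q ->
    graphical_derivative (solution_map M) pbar xbar q =
    [set u | graphical_derivative M (row_mx pbar xbar) 0 (row_mx q u) 0].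
Proof.
have [eps [L [eps0 L0 reg]]] := uniform_regularity M pbar xbar P hlc hii.
have [delta [L' [delta0 L'0 ref]]] :=
  solution_near_reference M pbar xbar P eps L hgph hi eps0 L0 reg.
split; first exact: (aubin_relativeI M P pbar xbar eps L delta L').
move=> q Tq; apply/seteqP; split => u /=.
  exact: graphical_derivative_solution_sub.
move=> DM; have [[q0 u0]|qu] := pselect ((q, u) = (0, 0)).
  apply/tangent_coneP => e e0; exists (e / 2), 0; rewrite q0 u0 row_mx0; split.
  - by rewrite divr_gt0.
  - by rewrite ltr_pdivrMr // ltr_pMr // ltr1n.
  - by rewrite subrr normr0.
  - by rewrite scaler0 addr0 gph_solution_map.
have [e [L1 [e0 L10 dreg]]] :=
  directional_regularity M pbar xbar q u hlc (hii q u Tq qu).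
exact: (graphical_derivative_solution_sup M pbar q xbar u e L1).
Qed.
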